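(* Let $\sigma \in \mathcal{C}_q$ with $\operatorname{des}(\sigma)=d$, and take an integer $k \geq \max\{d,2\}$. Then, for every $\sigma$-admissible vector $\boldsymbol{w} \in \mathbb{Z}^{k-1}$ there is a unique realization $\mathcal{O}$ of $\sigma$ under $\mathbf{m}_k$ with $\mathbf{dep}(\mathcal{O})=\boldsymbol{w}$.
   Context: Fix an integer $q\ge 2$. $\mathcal{S}_q$ is the group of permutations of $\mathbb{Z}/q\mathbb{Z}$, whose elements are identified with their representatives in $\{1,\dots,q\}$ (indices are taken modulo $q$, so $q+1$ means $1$). $\mathcal{C}_q\subset\mathcal{S}_q$ is the set of $q$-cycles (permutations acting transitively on $\mathbb{Z}/q\mathbb{Z}$). Descent number: $\operatorname{des}(\sigma)=\#\{i\in\mathbb{Z}/q\mathbb{Z}:\sigma(i)>\sigma(i+1)\}$, where the inequality uses the linear order of the representatives $1,\dots,q$ and $i=q$ is included (comparing $\sigma(q)$ with $\sigma(1)$). For $a\ne b$ in $\mathbb{Z}/q\mathbb{Z}$, $[a,b)$ denotes the cyclic interval $\{a,a+1,\dots,b-1\}$ (mod $q$). The signature of $\sigma\in\mathcal{C}_q$ is $\mathbf{sig}(\sigma)=(a_1,\dots,a_q)$ where $a_i=1$ if $i\in[\sigma(i),\sigma(i+1))$ and $a_i=0$ otherwise. If $d=\operatorname{des}(\sigma)$, exactly $d-1$ of the $a_i$ equal $1$; denote by $i_1<\dots<i_{d-1}$ (in $\{1,\dots,q\}$) the indices $i$ with $a_i=1$. For an integer $k\ge2$, $\mathbf{m}_k:\mathbb{R}/\mathbb{Z}\to\mathbb{R}/\mathbb{Z}$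 is $\mathbf{m}_k(x)=kx \pmod{\mathbb{Z}}$. Points of $\mathbb{R}/\mathbb{Z}$ are identified with their representatives in $[0,1)$. A period $q$ orbit is $\mathcal{O}=\{x_1,\dots,x_q\}$, with $q$ distinct points labeled so that $0<x_1<\dots<x_q<1$. $\mathcal{O}$ is a realization of $\sigma\in\mathcal{C}_q$ under $\mathbf{m}_k$ if $\mathbf{m}_k(x_i)=x_{\sigma(i)}$ for all $i$. The (cumulative) deployment vector of a period $q$ orbit $\mathcal{O}$ of $\mathbf{m}_k$ is $\mathbf{dep}(\mathcal{O})=(w_1,\dots,w_{k-1})$ with $w_i=\#\big(\mathcal{O}\cap(0,\tfrac{i}{k-1})\big)$. An integer vector $\boldsymbol{w}=(w_1,\dots,w_{k-1})$ is $\sigma$-admissible if (i) $0\le w_1\le\dots\le w_{k-1}=q$, and (ii) $i_1,\dots,i_{d-1}$ all appear among the components $w_1,\dots,w_{k-1}$ (condition (ii) is vacuous if $d=1$). *)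

(* Defs.v *)
From HB Require Import structures.
From mathcomp Require Import all_boot all_order all_algebra all_fingroup.
From mathcomp Require Import finmap reals.

Set Implicit Arguments.
Unset Strict Implicit.
Unset Printing Implicit Defensive.

Import Order.TTheory GRing.Theory Num.Theory.

Local Open Scope ring_scope.

(* Z/qZ is 'I_q, where i : 'I_q stands for the class with representative i.+1
   in {1, ..., q}.  This shift preserves the linear order of representatives
   and the cyclic successor, which is ordS. *)

Definition is_qcycle (q : nat) (s : {perm 'I_q}) : bool :=
  [transitive <[s]>%g, on [set: 'I_q] | 'P]%act.

Definition des (q : nat) (s : {perm 'I_q}) : nat :=
  #|[set i : 'I_q | (s (ordS i) < s i)%N]|.

(* The representative in {0, ..., q - 1} of the difference b - a in Z/qZ. *)
Definition cdist (q : nat) (a b : 'I_q) : nat := ((b + (q - a)) %% q)%N.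

(* [a, b) = {a, a + 1, ..., b - 1}; its elements are the a + n (mod q) with
   n smaller than the residue of b - a. *)
Definition cint (q : nat) (a b : 'I_q) : {set 'I_q} :=
  [set i : 'I_q | (cdist a i < cdist a b)%N].

Definition signature (q : nat) (s : {perm 'I_q}) : q.-tuple nat :=
  [tuple (i \in cint (s i) (s (ordS i)) : nat) | i < q].

(* The integer attached to i : 'I_q is its representative i.+1. *)
Definition admissible (q k : nat) (s : {perm 'I_q}) (w : k.-1.-tuple int) :
    Prop :=
  [/\ path <=%R 0 w,
      last 0 w = q%:Z
    & forall i : 'I_q, tnth (signature s) i = 1%N -> (i.+1)%:Z \in (w : seq int)].

(* Multiplication by k on R/Z, in terms of representatives in [0, 1). *)
Definition mulmod1 (R : realType) (k : nat) (x : R) : R :=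
  k%:R * x - (Num.floor (k%:R * x))%:~R.

Definition period_orbit (R : realType) (k q : nat) (O : {fset R}) : Prop :=
  #|` O| = q /\
  exists x : R, [/\ 0 <= x < 1,
    iter q (mulmod1 k) x = x
  & O = [fset iter n (mulmod1 k) x | n in iota 0 q]%fset].

Definition realization (R : realType) (k q : nat) (s : {perm 'I_q})
    (O : {fset R}) : Prop :=
  period_orbit k q O /\
  exists x : 'I_q -> R,
    [/\ O = [fset x i | i in 'I_q]%fset,
        forall i, 0 < x i < 1,
        forall i j : 'I_q, (i < j)%N -> x i < x j
      & forall i, mulmod1 k (x i) = x (s i)].

Definition dep (R : realType) (k : nat) (O : {fset R}) : k.-1.-tuple int :=
  [tuple Posz #|` [fset x in O | (0 < x < j.+1%:R / k.-1%:R)%R]%fset|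
    | j < k.-1].

(* Main.v *)
Require Import Defs.
From HB Require Import structures.
From mathcomp Require Import all_boot all_order all_algebra all_fingroup.
From mathcomp Require Import finmap reals.
From mathcomp Require Import zify lra ring.

Set Implicit Arguments.
Unset Strict Implicit.
Unset Printing Implicit Defensive.

Import Order.TTheory GRing.Theory Num.Theory.

Local Open Scope ring_scope.

(** A realization x_0 < ... < x_(q-1) of s under multiplication by k satisfies
    k x_i = f_i + x_(s i), where f_i is the integer part of k x_i, that is, the
    leading base-k digit of x_i.  The deployment vector determines these digits:
    (k - 1) x_i = f_i + (x_(s i) - x_i), and the difference x_(s i) - x_i lies
    in (0, 1) or in (-1, 0) according to whether s i is above or below i, so the
    integer part of (k - 1) x_i is f_i minus the indicator of s i < i.  This
    integer part is also the number of points c_j = (j + 1)/(k - 1), j < k - 1,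
    that are at most x_i, and c_j <= x_i means w_j <= i.  Hence
      f_i = #{j | w_j <= i} + [s i < i],
    which is [digit] below, where n stands for k - 1.

    Uniqueness: the linear system k x_i = f_i + x_(s i) has at most one solution
    because k > 1 ([solves_uniq]), and any realization with deployment vector w
    solves it for the digits above ([realization_digits]).

    Existence: the system is solvable because s has finite order
    ([solves_exists]), and everything reduces to showing that the solution lies
    in (0, 1) and is increasing in i ([digit_solution_incr]).  This is where
    admissibility enters: having i + 1 among the w_j whenever the signature of s
    is 1 at i is exactly what makes the digits nondecreasing and strictly
    increasing across each descent ([digit_succ]).  Thus the pairs (f_i, s i)
    are lexicographically increasing ([digit_lex]).  If x_j <= x_i for some i < j,
    then f_i = f_j, s i < s j and x_(s j) <= x_(s i), so the situation
    reproduces itself along the whole orbit; this is absurd at the moment when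
    the orbit of j reaches the least index. *)

(** * Initial segments of ordinals *)

Lemma card_ord_ltn (n m : nat) :
  (m <= n)%N -> #|[set i : 'I_n | (i < m)%N]| = m.
Proof.
move=> le_mn; have inj_w : injective (widen_ord le_mn).
  by move=> i j /(congr1 val)/= /val_inj.
rewrite -[RHS]card_ord -(card_imset _ inj_w); apply: eq_card => i.
rewrite inE; apply/idP/imsetP => [lt_im|[j _ ->]]; last exact: (ltn_ord j).
by exists (Ordinal lt_im) => //; apply: val_inj.
Qed.

(** Both the indices i with x_i below a given point and the indices j with w_j
    at most a given bound form initial segments, so that membership can be read
    off from the cardinal. *)
Lemma mem_initial_segment (n : nat) (D : {set 'I_n}) :
    (forall i j : 'I_n, (i <= j)%N -> j \in D -> i \in D) ->
  forall i : 'I_n, (i \in D) = (i < #|D|)%N.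
Proof.
move=> D_down i; apply/idP/idP => [Di|].
  rewrite -[X in (X <= _)%N](card_ord_ltn (ltn_ord i)).
  by apply/subset_leq_card/subsetP => j; rewrite inE ltnS => /D_down; apply.
apply: contraTT => nDi.
rewrite -leqNgt -[X in (_ <= X)%N](card_ord_ltn (ltnW (ltn_ord i))).
apply/subset_leq_card/subsetP => j Dj; rewrite inE ltnNge.
by apply: contra nDi => le_ij; apply: D_down Dj.
Qed.

(** * Cyclic permutations *)

Section QCycle.

Variables (q : nat) (s : {perm 'I_q}).
Hypothesis s_cycle : is_qcycle s.

Lemma qcycle_porbit (i : 'I_q) : porbit s i = [set: 'I_q].
Proof.
by rewrite porbit.unlock; apply: (atransP s_cycle); rewrite inE.
Qed.

Lemma qcycle_iter_period (i : 'I_q) : iter q s i = i.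
Proof. by rewrite -{2}(iter_porbit s i) qcycle_porbit cardsT card_ord. Qed.

Lemma qcycle_iter_lt (i j : 'I_q) :
  exists2 n, (n < q)%N & iter n s i = j.
Proof.
have: j \in porbit s i by rewrite qcycle_porbit inE.
rewrite porbit_traject qcycle_porbit cardsT card_ord.
by case/trajectP => n lt_nq ->; exists n.
Qed.

Lemma qcycle_iter (i j : 'I_q) : exists n, iter n s i = j.
Proof. by have [n _ <-] := qcycle_iter_lt i j; exists n. Qed.

Lemma qcycle_fixfree (i : 'I_q) : (1 < q)%N -> s i != i.
Proof.
move=> q_gt1; apply/eqP => s_i.
have iter_i n : iter n s i = i by elim: n => //= n ->.
have all_i (j : 'I_q) : j = i by have [n <-] := qcycle_iter i j.
have /(congr1 val) := all_i (Ordinal q_gt1).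
by rewrite -(all_i (Ordinal (ltnW q_gt1))).
Qed.

End QCycle.

(** * Base-k digits *)

Section Digits.

Variables (q : nat) (s : {perm 'I_q}) (n : nat) (w : n.-tuple int).

(** For an orbit with deployment vector w this counts the fixed points
    (j + 1) / n of multiplication by n + 1 that lie below the point of index i;
    it says in which gap between consecutive fixed points that point falls. *)
Definition gap (i : 'I_q) : nat := #|[set j : 'I_n | tnth w j <= i%:Z]|.

(** The integer part of (n + 1) x_i, in terms of s and w alone. *)
Definition digit (i : 'I_q) : nat := (gap i + (s i < i))%N.

(** Cyclic intervals in terms of the linear order of the representatives. *)
Lemma mem_cint (a b i : 'I_q) : (i \in cint a b) =
  if (a <= b)%N then (a <= i < b)%N else (a <= i)%N || (i < b)%N.
Proof.
have cdistE (c : 'I_q) :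
    cdist a c = (if (a <= c)%N then c - a else c + (q - a))%N.
  have := ltn_ord a; have := ltn_ord c; rewrite /cdist.
  case: (leqP a c) => ac cq aq.
    by rewrite (_ : (c + _ = (c - a) + q)%N) ?modnDr ?modn_small //; lia.
  by rewrite modn_small //; lia.
have := ltn_ord a; have := ltn_ord b; have := ltn_ord i.
rewrite inE !cdistE; case: (leqP a i) => ai; case: (leqP a b) => ab; lia.
Qed.

Hypothesis w_adm : @admissible q n.+1 s w.

Lemma admissible_mono (j j' : 'I_n) : (j <= j')%N -> tnth w j <= tnth w j'.
Proof.
case: w_adm => w_path _ _ le_jj'.
have w_sorted: sorted <=%R w by exact: path_sorted w_path.
rewrite !(tnth_nth 0); apply: (sorted_leq_nth le_trans le_refl) => //;
  by rewrite inE size_tuple.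
Qed.

Lemma admissible_last (j : 'I_n) : j.+1 = n -> tnth w j = q%:Z.
Proof.
case: w_adm => _ w_last _ jn.
rewrite (tnth_nth 0) -w_last -nth_last size_tuple.
by congr (nth _ _ _) => /=; lia.
Qed.

Lemma admissible_bounds (j : 'I_n) : 0 <= tnth w j <= q%:Z.
Proof.
case: w_adm => w_path _ _; apply/andP; split.
  by have /(order_path_min le_trans)/allP := w_path; apply; apply: mem_tnth.
have lt_n: (n.-1 < n)%N by have := ltn_ord j; lia.
have le_jn : (j <= Ordinal lt_n)%N by have := ltn_ord j; move=> /=; lia.
by rewrite -(@admissible_last (Ordinal lt_n)) ?admissible_mono //=; lia.
Qed.

Lemma leq_gap (i : 'I_q) (j : 'I_n) : (gap i <= j)%N = (i%:Z < tnth w j).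
Proof.
rewrite leqNgt -(mem_initial_segment (D := [set j | tnth w j <= i%:Z])).
  by rewrite inE -ltNge.
by move=> j1 j2 le12; rewrite !inE; apply: le_trans; apply: admissible_mono.
Qed.

Lemma gap_lt (i : 'I_q) : (0 < n)%N -> (gap i < n)%N.
Proof.
move=> n_gt0; have lt_n: (n.-1 < n)%N by rewrite prednK.
have -> : (gap i < n)%N = (gap i <= Ordinal lt_n)%N by move=> /=; lia.
by rewrite leq_gap admissible_last ?ltz_nat //= prednK.
Qed.

(** If the signature of s is 1 at i, then i + 1 is one of the w_m, and this m is
    counted by the gap of i + 1 but not by that of i. *)
Lemma gap_succ (i j : 'I_q) : j = i.+1 :> nat ->
  (gap i + (i \in cint (s i) (s j)) <= gap j)%N.
Proof.
move=> ji; have le_ij : (i%:Z <= j%:Z) by rewrite lez_nat ji.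
have sub_ij : [set m | tnth w m <= i%:Z] \subset [set m | tnth w m <= j%:Z].
  by apply/subsetP => m; rewrite !inE => /le_trans; apply.
case: (boolP (i \in _)) => sig_i; last first.
  by rewrite addn0; apply: subset_leq_card.
rewrite addn1; apply: proper_card; rewrite properE sub_ij /=.
case: w_adm => _ _ /(_ i).
rewrite tnth_mktuple (_ : ordS i = j); last first.
  by apply: val_inj; rewrite /= modn_small -ji.
rewrite sig_i => /(_ erefl)/tnthP[m wm].
by apply/subsetPn; exists m; rewrite inE -wm ?ji // -ltNge ltz_nat.
Qed.

Lemma digit_le (i : 'I_q) : (0 < n)%N -> (digit i <= n)%N.
Proof. by move=> n_gt0; have := gap_lt i n_gt0; rewrite /digit; lia. Qed.

Hypothesis q_gt1 : (1 < q)%N.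
Hypothesis s_cycle : is_qcycle s.

(** The indicator of s i < i may drop by one when passing from i to j = i + 1,
    and a descent requires an increase.  In the cases where the indicators alone
    do not give what is required, i lies in the cyclic interval [s i, s j), so
    that the gap increases. *)
Lemma digit_succ (i j : 'I_q) : j = i.+1 :> nat ->
  (digit i + (s j < s i) <= digit j)%N.
Proof.
move=> ji; have := gap_succ ji; rewrite /digit mem_cint.
have /eqP := qcycle_fixfree s_cycle i q_gt1.
have /eqP := qcycle_fixfree s_cycle j q_gt1.
have: s i <> s j by move/perm_inj => ij; move: ji; rewrite ij; lia.
have ordP (a b : 'I_q) : a <> b -> nat_of_ord a <> b.
  by move=> ab /val_inj.
move=> /ordP sij /ordP sjj /ordP sii.
case: (leqP (s i) (s j)) => ?; lia.
Qed.

(** Consecutive indices are covered by [digit_succ], since s j = s i is excluded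
    by injectivity; lexicographic order is transitive. *)
Lemma digit_lex (i j : 'I_q) : (i < j)%N ->
  (digit i < digit j)%N || (digit i == digit j) && (s i < s j)%N.
Proof.
have [m] := ubnP (j : nat); elim: m j => // m IHm j lt_jm lt_ij.
(* the predecessor of j *)
have lt_jq := ltn_ord j; have lt_pq : (j.-1 < q)%N by lia.
pose p := Ordinal lt_pq.
have jp : j = p.+1 :> nat by rewrite /=; lia.
have sjp : nat_of_ord (s j) <> s p.
  by move/val_inj/perm_inj/(congr1 val) => /= jp'; lia.
have := digit_succ jp; have [ip|lt_ip] := eqVneq i p; first by rewrite ip; lia.
have : (i < p)%N.
  by rewrite ltn_neqAle lt_ip /=; lia.
by move=> /IHm; have -> : (p < m)%N by [lia]; move=> /(_ isT); lia.
Qed.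

(** With constant digits [digit_lex] would make s increasing, hence s would fix
    the least index.  This excludes the solutions 0 and 1 of the linear system,
    which belong to the constant digits 0 and n. *)
Lemma digit_nonconst (c : nat) : exists i, digit i != c.
Proof.
apply/existsP; apply: contraT => /existsPn const.
pose z : 'I_q := Ordinal (ltnW q_gt1).
pose p := (s^-1)%g z; have sp : s p = z by rewrite permKV.
have zp : z != p.
  by apply: contraNneq (qcycle_fixfree s_cycle z q_gt1) => {1}->; rewrite sp.
have /digit_lex : (z < p)%N.
  by rewrite lt0n; apply: contraNneq zp => p0; apply/eqP/val_inj.
have /negPn/eqP-> := const z; have /negPn/eqP-> := const p.
by rewrite sp ltnn andbF.
Qed.

End Digits.

(** * The cyclic linear system *)

Section System.

Variables (F : realFieldType) (q : nat) (s : {perm 'I_q}) (k : F).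
Hypothesis k_gt1 : 1 < k.

Definition solves (f x : 'I_q -> F) := forall i, k * x i = f i + x (s i).

(** A minimum principle: where x is least, at m say, x (s m) >= x m gives
    (k - 1) x m >= f m >= 0. *)
Lemma solves_ge0 (f x : 'I_q -> F) :
  solves f x -> (forall i, 0 <= f i) -> forall i, 0 <= x i.
Proof.
move=> sx f_ge0 i.
case: (@Order.TotalTheory.arg_minP _ _ _ i predT x isT) => m _ min_m.
apply: le_trans (min_m i isT).
have k1_gt0 : 0 < k - 1 by rewrite subr_gt0.
rewrite -(pmulr_rge0 _ k1_gt0) mulrBl mul1r sx subr_ge0.
by rewrite -[X in X <= _]add0r lerD // min_m.
Qed.

Lemma solves_uniq (f x y : 'I_q -> F) : solves f x -> solves f y -> x =1 y.
Proof.
move=> sx sy i.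
have sxy: solves (fun=> 0) (fun i => x i - y i).
  by move=> j; rewrite mulrBr sx sy; ring.
have syx: solves (fun=> 0) (fun i => y i - x i).
  by move=> j; rewrite mulrBr sx sy; ring.
have := solves_ge0 sxy (fun=> lexx 0) i.
have := solves_ge0 syx (fun=> lexx 0) i.
by rewrite !subr_ge0 => yx xy; apply/le_anti/andP.
Qed.

Hypothesis s_cycle : is_qcycle s.

(** A zero of x at i forces zeros of f at i and of x at s i, hence, going round
    the cycle, f = 0. *)
Lemma solves_gt0 (f x : 'I_q -> F) : solves f x -> (forall i, 0 <= f i) ->
  (exists i, f i != 0) -> forall i, 0 < x i.
Proof.
move=> sx f_ge0 [j fj] i; have x_ge0 := solves_ge0 sx f_ge0.
rewrite lt_def x_ge0 andbT; apply: contra_neqN fj => /eqP xi0.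
have zero m : x (iter m s i) = 0.
  elim: m => //= m; have := sx (iter m s i); have := f_ge0 (iter m s i).
  have := x_ge0 (s (iter m s i)) => *; nra.
have [m <-] := qcycle_iter s_cycle i j.
by have := sx (iter m s i); rewrite zero (zero m.+1) mulr0 addr0.
Qed.

(** The sum of f (s^j i) k^(m-1-j) over j < m, which for f with values in the
    base-k digits is the integer written f i, f (s i), f (s (s i)), ... *)
Fixpoint horner_orbit (f : 'I_q -> F) (m : nat) (i : 'I_q) : F :=
  if m is m'.+1 then k * horner_orbit f m' i + f (iter m' s i) else 0.

Lemma horner_orbit_shift (f : 'I_q -> F) m i :
  horner_orbit f m.+1 i = f i * k ^+ m + horner_orbit f m (s i).
Proof.
elim: m => [|m IHm] /=; first by ring.
by move: IHm => /= ->; rewrite -iterS iterSr exprS; ring.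
Qed.

(** The solution at i is the number with periodic base-k expansion
    f i, f (s i), f (s (s i)), ... of period q. *)
Lemma solves_exists (f : 'I_q -> F) : (0 < q)%N -> exists x, solves f x.
Proof.
move=> q_gt0; exists (fun i => horner_orbit f q i / (k ^+ q - 1)) => i.
have kq : k ^+ q - 1 != 0.
  by rewrite subr_eq0 gt_eqF // exprn_egt1 // -lt0n.
have := horner_orbit_shift f q i; rewrite /= qcycle_iter_period // => shift.
have {}shift : k * horner_orbit f q i
    = f i * (k ^+ q - 1) + horner_orbit f q (s i).
  by rewrite mulrBr mulr1 addrAC -shift addrK.
by rewrite mulrA shift mulrDl mulfK.
Qed.

End System.

(** * Realizations and deployment vectors *)

Section Realizations.

Variables (R : realType) (q : nat) (s : {perm 'I_q}) (n : nat).
Hypothesis q_gt1 : (1 < q)%N.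
Hypothesis s_cycle : is_qcycle s.
Hypothesis n_gt0 : (0 < n)%N.

Definition increasing01 (x : 'I_q -> R) : Prop :=
  (forall i, 0 < x i < 1) /\ (forall i j : 'I_q, (i < j)%N -> x i < x j).

Lemma increasing01_inj (x : 'I_q -> R) : increasing01 x -> injective x.
Proof.
case=> _ x_incr i j xij; apply: val_inj.
by case: (ltngtP i j) => // /x_incr; rewrite xij ltxx.
Qed.

(** This quantity is the fractional part of n x_i when (n + 1) x_i differs from
    x_(s i) by an integer. *)
Lemma drift_bounds (x : 'I_q -> R) (i : 'I_q) : increasing01 x ->
  0 < (s i < i)%N%:R + x (s i) - x i < 1.
Proof.
case=> x01 x_incr; have /andP[xi0 xi1] := x01 i.
have /andP[xs0 xs1] := x01 (s i).
case: (ltngtP (s i) i) => [/x_incr|/x_incr|/val_inj si] /=; try lra.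
by have := qcycle_fixfree s_cycle i q_gt1; rewrite si eqxx.
Qed.

(** The integer part of n x_i is m, because n x_i is the sum of m and of the
    quantity bounded in [drift_bounds]. *)
Lemma lt_fixpoint (x : 'I_q -> R) (i : 'I_q) (m : nat) (j : 'I_n) :
    increasing01 x -> n.+1%:R * x i = (m + (s i < i))%N%:R + x (s i) ->
  (x i < j.+1%:R / n%:R) = (m <= j)%N.
Proof.
move=> x_incr xi; have := drift_bounds i x_incr.
rewrite ltr_pdivlMr ?ltr0n //; move: xi; rewrite -natr1 natrD.
move: (_ < _)%N%:R => e xi He.
have {xi} -> : x i * n%:R = m%:R + (e + x (s i) - x i) by lra.
case: leqP => [le_mj|lt_jm].
  have : m.+1%:R <= j.+1%:R :> R by rewrite ler_nat.
  rewrite -[m.+1%:R]natr1; lra.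
have : j.+1%:R <= m%:R :> R by rewrite ler_nat.
by move=> ?; apply/negbTE; rewrite -leNgt; lra.
Qed.

Lemma tnth_dep (x : 'I_q -> R) (j : 'I_n) : increasing01 x ->
  tnth (dep n.+1 [fset x i | i in 'I_q]%fset) j
    = #|[set i | x i < j.+1%:R / n%:R]|%:Z.
Proof.
move=> x_incr; rewrite tnth_mktuple /=; congr Posz.
have x_inj := increasing01_inj x_incr; case: x_incr => x01 _.
transitivity #|` [fset x i | i in [set i | x i < j.+1%:R / n%:R]]%fset|.
  congr #|` _|; apply/fsetP => y; rewrite !inE.
  apply/andP/imfsetP => /= [[/imfsetP[i _ ->] /andP[_ lt_xi]]|[i]].
    by exists i; rewrite ?inE.
  rewrite inE => lt_xi ->; split; first by apply/imfsetP; exists i.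
  by have /andP[-> _] := x01 i.
by rewrite card_imfset //= -cardE.
Qed.

Variable w : n.-tuple int.
Hypothesis w_adm : @admissible q n.+1 s w.

Definition digitR (i : 'I_q) : R := (digit s w i)%:R.

(** The integer part m of n x_i and the gap of i compare in the same way with
    every j < n, by [lt_fixpoint] and [leq_gap]; being both less than n, they
    are equal. *)
Lemma realization_digits (O : {fset R}) :
    realization n.+1 s O -> dep n.+1 O = w ->
  exists x : 'I_q -> R,
    O = [fset x i | i in 'I_q]%fset /\ solves s n.+1%:R digitR x.
Proof.
case=> _ [x [-> x01 x_lt x_map]] dep_w; exists x; split=> // i.
have x_incr : increasing01 x by split.
set z := Num.floor (n.+1%:R * x i).
have xi : n.+1%:R * x i = z%:~R + x (s i).
  by rewrite -x_map /mulmod1 addrC subrK.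
have /andP[e0 e1] := drift_bounds i x_incr; have /andP[xi0 xi1] := x01 i.
pose e : nat := (s i < i)%N; rewrite -/e in e0 e1.
have n1 : n.+1%:R = n%:R + 1 :> R by rewrite natr1.
have nR : 0 < n%:R :> R by rewrite ltr0n.
have [m zm] : exists m : nat, z = (m + e)%N%:Z.
  have : (0 : R) < (z - e%:Z + 1)%:~R.
    rewrite rmorphD rmorphB /= -pmulrn; nra.
  rewrite ltr0z => ze; exists `|z - e%:Z|%N; lia.
rewrite xi zm -pmulrn; congr (_%:R + _); congr addn.
have lt_x (j : 'I_n) : (x i < j.+1%:R / n%:R) = (gap w i <= j)%N.
  rewrite (leq_gap w_adm) -dep_w tnth_dep // ltz_nat.
  rewrite -(mem_initial_segment (D := [set i | x i < j.+1%:R / n%:R])) ?inE //.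
  move=> i1 i2; rewrite leq_eqVlt !inE => /orP[/eqP/val_inj->//|/x_lt].
  exact: lt_trans.
have gap_m (j : 'I_n) : (gap w i <= j)%N = (m <= j)%N.
  by rewrite -lt_x; apply: lt_fixpoint => //; rewrite xi zm pmulrn.
have lt_mn : (m < n)%N.
  rewrite -(ltr_nat R); have := xi; rewrite zm -pmulrn natrD n1; nra.
have lt_gn := gap_lt w_adm i n_gt0.
apply/eqP; rewrite eqn_leq.
by rewrite -(gap_m (Ordinal lt_gn)) (gap_m (Ordinal lt_mn)) !leqnn.
Qed.

Lemma digit_solution_incr (x : 'I_q -> R) :
  solves s n.+1%:R digitR x -> increasing01 x.
Proof.
move=> sx; have k_gt1 : 1 < n.+1%:R :> R by rewrite ltr1n.
have n1 : n.+1%:R = n%:R + 1 :> R by rewrite natr1.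
have x_gt0 : forall i, 0 < x i.
  apply: (solves_gt0 k_gt1 s_cycle sx) => [i|]; first exact: ler0n.
  have [i di] := digit_nonconst w_adm q_gt1 s_cycle 0.
  by exists i; rewrite pnatr_eq0.
(* 1 - x solves the system for the complementary digits n - f. *)
have x_lt1 i : x i < 1.
  rewrite -subr_gt0.
  apply: (solves_gt0 k_gt1 s_cycle
    (f := fun i => n%:R - digitR i) (x := fun i => 1 - x i)) => [j|j|].
  - by rewrite mulrBr sx n1; ring.
  - by rewrite subr_ge0 ler_nat (digit_le w_adm).
  have [j dj] := digit_nonconst w_adm q_gt1 s_cycle n.
  by exists j; rewrite subr_eq0 eqr_nat eq_sym.
split=> [i|i j lt_ij]; first by rewrite x_gt0 x_lt1.
rewrite ltNge; apply/negP => le_x.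
(* If f a < f b, then x a < (f a + 1) / (n + 1) <= f b / (n + 1) < x b; hence
   the digits agree, and a wrong order of x a and x b passes to s a and s b. *)
have iter_lt m :
    (iter m s i < iter m s j)%N /\ x (iter m s j) <= x (iter m s i).
  elim: m => //= m [lt_m le_m].
  have := digit_lex w_adm q_gt1 s_cycle lt_m; move: lt_m le_m.
  move: (iter m s i) (iter m s j) => a b _ le_ba lex.
  have xa := sx a; have xb := sx b; rewrite /digitR in xa xb.
  have xsb := x_gt0 (s b); have xsa := x_lt1 (s a).
  case/orP: lex => [|/andP[/eqP dab lt_s]].
    by rewrite -(ler_nat R) -natr1; nra.
  by split=> //; rewrite dab in xa; nra.
(* No index is below the least one. *)
have [m jm] := qcycle_iter s_cycle j (Ordinal (ltnW q_gt1)).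
by have [] := iter_lt m; rewrite jm.
Qed.

Lemma digit_solution_map (x : 'I_q -> R) : solves s n.+1%:R digitR x ->
  forall i, mulmod1 n.+1 (x i) = x (s i).
Proof.
move=> sx i; have [x01 _] := digit_solution_incr sx.
have /andP[xs0 xs1] := x01 (s i).
rewrite /mulmod1 sx /digitR; move: (digit s w i) => f.
have -> : Num.floor (f%:R + x (s i)) = f%:Z.
  by apply: floor_def; rewrite intrD -pmulrn; apply/andP; split; lra.
by rewrite -pmulrn addrC addKr.
Qed.

Lemma digit_solution_realization (x : 'I_q -> R) :
  solves s n.+1%:R digitR x ->
  realization n.+1 s [fset x i | i in 'I_q]%fset.
Proof.
move=> sx; have x_incr := digit_solution_incr sx.
have x_map := digit_solution_map sx; have [x01 x_lt] := x_incr.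
have x_iter m i : iter m (mulmod1 n.+1) (x i) = x (iter m s i).
  by elim: m => //= m ->.
split; last by exists x; split.
split.
  rewrite card_imfset /=; last exact: increasing01_inj.
  by rewrite -cardE card_ord.
pose z : 'I_q := Ordinal (ltnW q_gt1); exists (x z); split.
- by have /andP[x0 x1] := x01 z; rewrite ltW.
- by rewrite x_iter qcycle_iter_period.
apply/fsetP => y; apply/imfsetP/imfsetP => /= [[i _ ->]|[m m_q ->]].
  have [m lt_mq <-] := qcycle_iter_lt s_cycle z i.
  by exists m; rewrite ?x_iter // mem_iota.
by exists (iter m s z).
Qed.

Lemma digit_solution_dep (x : 'I_q -> R) : solves s n.+1%:R digitR x ->
  dep n.+1 [fset x i | i in 'I_q]%fset = w.
Proof.
move=> sx; have x_incr := digit_solution_incr sx.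
apply: eq_from_tnth => /= j; rewrite tnth_dep //.
have /andP[wj0 wj_q] := admissible_bounds w_adm j.
have [v wv] : exists v : nat, tnth w j = v%:Z by exists `|tnth w j|%N; lia.
rewrite wv in wj_q *; rewrite -[in RHS](@card_ord_ltn q v) //.
congr Posz; apply: eq_card => i; rewrite !inE.
rewrite (lt_fixpoint (m := gap w i)) //; last exact: sx.
by rewrite (leq_gap w_adm) wv ltz_nat.
Qed.

End Realizations.

Theorem mainTheorem1 (R : realType) (q : nat) (hq : (2 <= q)%N)
    (s : {perm 'I_q}) (hs : is_qcycle s) (d : nat) (hd : des s = d)
    (k : nat) (hk : (maxn d 2 <= k)%N)
    (w : k.-1.-tuple int) (hw : admissible s w) :
  exists! O : {fset R}, realization k s O /\ dep k O = w.
Proof.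
have : (1 < k)%N by move: hk; rewrite geq_max => /andP[].
case: k w hw {hk} => [//|n] w hw n_gt0; rewrite ltnS in n_gt0.
have k_gt1 : 1 < n.+1%:R :> R by rewrite ltr1n.
have [x sx] := solves_exists k_gt1 hs (digitR R s w) (ltnW hq).
exists [fset x i | i in 'I_q]%fset; split.
  split; first exact: (@digit_solution_realization _ _ _ _ hq hs n_gt0 w hw).
  exact: (@digit_solution_dep _ _ _ _ hq hs n_gt0 w hw).
move=> O' [O'_real O'_dep].
have [y [-> sy]] :=
  @realization_digits _ _ _ _ hq hs n_gt0 w hw _ O'_real O'_dep.
exact: eq_imfset (solves_uniq k_gt1 sx sy) (fun=> erefl).
Qed.
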